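(* Let $0<c_{1}\leq c_{2}<\infty$ be fixed constants. Given $1/2 \leq s < 1$ and $A > 0$, there are numbers $p = p(s,A) \in \mathbb{N}$, $p\geq 1$, and $\delta(A,s) > 0$ (depending only on $s$, $A$ and the fixed constants $c_{1},c_{2}$) with the following property. Let $$S_{p} := \{e^{2\pi i k/p} : 0 \leq k < p\} \subset S^{1},$$ and let $\emptyset \neq K \subset B(0,1)\subset \mathbb{R}^{2}$ be a $1$-Ahlfors-David regular set with $c_{1}\leq \mathcal{H}^{1}(K) \leq c_{2}$ and regularity constant at most $A$. Then $$\frac{1}{p} \sum_{e \in S_{p}} N(\pi_{e}(K),\delta) \geq \delta^{-s}, \qquad 0 < \delta \leq \delta(A,s).$$ In particular, $\overline{\dim}_{\mathrm{B}}\, \pi_{e}(K) \geq s$ for some $e \in S_{p}$.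
   Context: $\mathbb{R}^{2}$ is identified with $\mathbb{C}$, so $S_p$ is a set of $p$ unit vectors. $B(x,r)$ is the closed ball of centre $x$ and radius $r$. $\pi_{e}$ is the orthogonal projection of $\mathbb{R}^2$ onto $\operatorname{span}(e)$. $N(A',r)$ is the least number of balls of radius $r$ needed to cover $A'$. $\mathcal{H}^{1}$ is $1$-dimensional Hausdorff measure. An $\mathcal{H}^{1}$-measurable set $K\subset\mathbb{R}^2$ is $1$-Ahlfors-David regular with regularity constant at most $A$ (also: $(1,A)$-AD regular) if $0 < \mathcal{H}^{1}(K) < \infty$ and the restriction $\mu := \mathcal{H}^{1}|_{K}$ satisfies $$\frac{r}{A} \leq \mu(B(x,r)) \leq Ar \qquad \text{for all } x \in \operatorname{spt}\mu \text{ and } 0 < r \leq \operatorname{diam}(\operatorname{spt}\mu).$$ The upper box dimension of a bounded set $A'$ is $\overline{\dim}_{\mathrm{B}} A' := \limsup_{\delta \to 0} \frac{\log N(A',\delta)}{-\log \delta}$. *)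

(* Defs.v *)
From mathcomp Require Import all_boot all_order all_algebra.
From mathcomp Require Import all_classical all_reals all_analysis.

Set Implicit Arguments.
Unset Strict Implicit.
Unset Printing Implicit Defensive.

Import Order.TTheory GRing.Theory Num.Theory.
Import numFieldNormedType.Exports.

Local Open Scope classical_set_scope.
Local Open Scope ring_scope.

Definition dotv (R : realType) (n : nat) (u v : 'rV[R]_n) : R :=
  \sum_(i < n) u ord0 i * v ord0 i.

(* The canonical norm of the matrix type ['rV[R]_n] is the sup norm, so the
   Euclidean distance and its balls and diameters are introduced separately. *)
Definition edist (R : realType) (n : nat) (x y : 'rV[R]_n) : R :=
  Num.sqrt (dotv (x - y) (x - y)).

Definition eball (R : realType) (n : nat) (x : 'rV[R]_n) (r : R) :
  set 'rV[R]_n := [set y | edist x y <= r].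

(* [maxe 0] only matters for the empty set, whose diameter is 0. *)
Definition ediam (R : realType) (n : nat) (E : set 'rV[R]_n) : \bar R :=
  maxe 0%E (ereal_sup [set (edist x y)%:E | x in E & y in E]).

Definition hausdorff1_premeasure (R : realType) (n : nat) (d : R)
    (E : set 'rV[R]_n) : \bar R :=
  ereal_inf [set (\sum_(0 <= i <oo) ediam (U i))%E
            | U in [set U : nat -> set 'rV[R]_n |
                    E `<=` \bigcup_i U i /\
                    forall i, (ediam (U i) <= d%:E)%E]].

(* One-dimensional Hausdorff (outer) measure: the limit as [d] decreases to 0
   of the premeasures, which increase as [d] decreases. In dimension one the
   normalisations [diam] and [2 * (diam / 2)] coincide. *)
Definition hausdorff1 (R : realType) (n : nat) (E : set 'rV[R]_n) : \bar R :=
  ereal_sup [set hausdorff1_premeasure d E | d in [set d : R | 0 < d]].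

Definition hausdorff1_restr (R : realType) (n : nat) (K : set 'rV[R]_n) :
  set 'rV[R]_n -> \bar R := fun E => hausdorff1 (E `&` K).

Definition msupport (R : realType) (n : nat) (mu : set 'rV[R]_n -> \bar R) :
  set 'rV[R]_n := [set x | forall r, 0 < r -> (0 < mu (eball x r))%E].

Definition AD_regular1 (R : realType) (n : nat) (A : R) (K : set 'rV[R]_n) :
  Prop :=
  let mu := hausdorff1_restr K in
  [/\ (@hausdorff1 R n).-caratheodory K,
      (0 < hausdorff1 K < +oo)%E &
      forall (x : 'rV[R]_n) (r : R), msupport mu x ->
        0 < r -> (r%:E <= ediam (msupport mu))%E ->
        ((r / A)%:E <= mu (eball x r) <= (A * r)%:E)%E].

(* [e] is meant to be a unit vector. *)
Definition proj_line (R : realType) (n : nat) (e x : 'rV[R]_n) : 'rV[R]_n :=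
  dotv x e *: e.

(* The centres may be any points of the ambient space; the value is [+oo] when
   no finite cover exists. *)
Definition covering_number (R : realType) (n : nat) (E : set 'rV[R]_n)
    (r : R) : \bar R :=
  ereal_inf [set m%:R%:E | m in [set m : nat |
    exists c : 'I_m -> 'rV[R]_n, E `<=` \bigcup_i eball (c i) r]].

Definition upper_box_dim (R : realType) (n : nat) (E : set 'rV[R]_n) :
  \bar R :=
  limf_esup (fun d : R => lne (covering_number E d) * ((- ln d)^-1)%:E)%E
            (0 : R)^'+.

Definition unit_vec (R : realType) (t : R) : 'rV[R]_2 :=
  \row_(i < 2) (if i == ord0 then cos t else sin t).

Definition directions (R : realType) (p : nat) : set 'rV[R]_2 :=
  [set unit_vec (2 * pi * k%:R / p%:R) | k in `I_p].

(* Main.v *)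
From HB Require Import structures.
From Pilot Require (* Restores [edist] as the Euclidean distance, a name that is also that of the
   extended distance of a pseudometric space. *)
Import Defs.
From mathcomp Require Import all_boot all_order all_algebra.
From mathcomp Require Import all_classical all_reals all_analysis.
From mathcomp Require Import ring lra zify.

Set Implicit Arguments.
Unset Strict Implicit.
Unset Printing Implicit Defensive.

Import Order.TTheory GRing.Theory Num.Theory.
Import numFieldNormedType.Exports.
Import Defs.

Local Open Scope classical_set_scope.
Local Open Scope ring_scope.

(** Fix a scale ratio [2 ^- J] and take [p = 4 * 2 ^ J] directions. Let [x] be a
    point of the support of [mu], the restriction of the Hausdorff measure to
    [K], and write [rho = r / 2 ^ J]. Choose in the support a [rho]-separated net
    [s] of the ball of centre [x] and radius [r / 2]. Regularity forces [s] to
    have about [2 ^ J] points ([ball_regular_net]), and at most about [t / rho]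
    of them lie in a ball of radius [t] ([separated_size_le]).

    Let [m e y] be the number of points of [s] whose projection to the line of
    [e] is within [4 rho] of that of [y]. Counting how often each ball of a cover
    of the projection of [K] near [x] is used by the pieces of [K] near the
    points of [s] gives
      [N(x, r) >= sum_(y in s) N(y, rho) / m e y],
    where [N(x, r)] is the covering number, at the fixed final scale [delta], of
    the projection of the part of [K] in the ball of centre [x] and radius [r]
    ([proj_covered_pieces]). Taking logarithms and applying Jensen's inequality,
      [ln N(x, r) >= ln (size s) + mean_y (ln N(y, rho) - ln (m e y))].
    This inequality is additive, so it can be averaged over the directions and
    then iterated over the scales, although the same finite set of directions
    serves at all of them.

    What makes the average over directions favourable is that two points at
    distance [2 ^ j rho] have projections within [4 rho] only for a proportion
    [2 ^- j] of the directions ([card_directions_dyadic]), while a point of [s]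
    has at most about [2 ^ j] others at that distance. Hence each of the [J + 1]
    values of [j] contributes a bounded amount to the mean of [m e y] over [e],
    which is of the order of [J] ([sum_fibre_mult_le]). One scale therefore
    contributes [J ln 2 - O(ln J)] to the mean of [ln N], which exceeds
    [s' J ln 2] for a given [s' < 1] once [J] is large ([exists_scale_gain]).
    About [ln (1 / delta) / (J ln 2)] scales fit above [delta], so the mean of
    [ln N] is at least [s ln (1 / delta)] for small [delta], and Jensen's
    inequality turns this into a lower bound for the mean of [N]
    ([mean_proj_covered_ge]). The statement on box dimensions follows by
    pigeonholing the finitely many directions.

    On the side of measure theory, the packing bounds need that Hausdorff measure
    is an outer measure, additive on sets at positive distance, and that the
    complement of the support is null. *)

(** * Euclidean geometry of row vectors *)

Lemma dotvC (R : realType) n (u v : 'rV[R]_n) : dotv u v = dotv v u.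
Proof. by apply: eq_bigr => i _; rewrite mulrC. Qed.

Lemma dotvDl (R : realType) n (u v w : 'rV[R]_n) :
  dotv (u + v) w = dotv u w + dotv v w.
Proof.
by rewrite /dotv -big_split; apply: eq_bigr => i _; rewrite mxE mulrDl.
Qed.

Lemma dotvZl (R : realType) n (a : R) (u w : 'rV[R]_n) :
  dotv (a *: u) w = a * dotv u w.
Proof.
by rewrite /dotv mulr_sumr; apply: eq_bigr => i _; rewrite mxE mulrA.
Qed.

Lemma dotvNl (R : realType) n (u w : 'rV[R]_n) : dotv (- u) w = - dotv u w.
Proof. by rewrite -scaleN1r dotvZl mulN1r. Qed.

Lemma dotvBl (R : realType) n (u v w : 'rV[R]_n) :
  dotv (u - v) w = dotv u w - dotv v w.
Proof. by rewrite dotvDl dotvNl. Qed.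

Lemma dotvDr (R : realType) n (u v w : 'rV[R]_n) :
  dotv w (u + v) = dotv w u + dotv w v.
Proof. by rewrite dotvC dotvDl !(dotvC w). Qed.

Lemma dotvZr (R : realType) n (a : R) (u w : 'rV[R]_n) :
  dotv w (a *: u) = a * dotv w u.
Proof. by rewrite dotvC dotvZl dotvC. Qed.

Lemma dotvBr (R : realType) n (u v w : 'rV[R]_n) :
  dotv w (u - v) = dotv w u - dotv w v.
Proof. by rewrite dotvC dotvBl !(dotvC w). Qed.

Lemma dotvv_ge0 (R : realType) n (u : 'rV[R]_n) : 0 <= dotv u u.
Proof. by apply: sumr_ge0 => i _; rewrite -expr2 sqr_ge0. Qed.

Lemma dotvv_eq0 (R : realType) n (u : 'rV[R]_n) : dotv u u = 0 -> u = 0.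
Proof.
move/eqP; rewrite psumr_eq0 => [/allP u0|i _]; last by rewrite -expr2 sqr_ge0.
apply/rowP => i; rewrite mxE.
by have := u0 i (mem_index_enum i); rewrite -expr2 sqrf_eq0 => /eqP.
Qed.

(** The vector [(v.v) u - (u.v) v] has a nonnegative square. *)
Lemma dotv_CauchySchwarz (R : realType) n (u v : 'rV[R]_n) :
  dotv u v ^+ 2 <= dotv u u * dotv v v.
Proof.
have [v0|] := eqVneq (dotv v v) 0.
  rewrite (dotvv_eq0 v0) -(scale0r (0 : 'rV[R]_n)) !dotvZr.
  by rewrite !mul0r mulr0 expr0n.
move=> vN0; have v_gt0 : 0 < dotv v v by rewrite lt_def vN0 dotvv_ge0.
have := dotvv_ge0 (dotv v v *: u - dotv u v *: v).
rewrite dotvBl !dotvBr !dotvZl !dotvZr (dotvC v u) => h.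
rewrite -subr_ge0 -(pmulr_rge0 _ v_gt0); apply: le_trans h _.
by rewrite le_eqVlt; apply/orP; left; apply/eqP; ring.
Qed.

Lemma euclid_ge0 (R : realType) n (x y : 'rV[R]_n) : 0 <= edist x y.
Proof. exact: sqrtr_ge0. Qed.

Lemma euclidC (R : realType) n (x y : 'rV[R]_n) : edist x y = edist y x.
Proof.
by rewrite /edist -(opprB y x) -scaleN1r dotvZl dotvZr !mulN1r opprK.
Qed.

Lemma sqr_euclid (R : realType) n (x y : 'rV[R]_n) :
  edist x y ^+ 2 = dotv (x - y) (x - y).
Proof. by rewrite sqr_sqrtr ?dotvv_ge0. Qed.

Lemma euclid_triangle (R : realType) n (y x z : 'rV[R]_n) :
  edist x z <= edist x y + edist y z.
Proof.
rewrite -ler_sqr ?nnegrE ?addr_ge0 ?euclid_ge0//.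
rewrite sqr_euclid sqrrD !sqr_euclid.
have -> : x - z = (x - y) + (y - z) by rewrite addrA subrK.
set u := x - y; set v := y - z.
rewrite (dotvDl u v) 2!(dotvDr u v) (dotvC v u).
suff : dotv u v <= edist x y * edist y z by rewrite -mulr_natr; lra.
rewrite (le_trans (ler_norm _))// -ler_sqr ?nnegrE ?mulr_ge0 ?euclid_ge0//.
by rewrite exprMn !sqr_euclid real_normK ?num_real// dotv_CauchySchwarz.
Qed.

Lemma sub_eball (R : realType) n (x y : 'rV[R]_n) (r r' : R) :
  edist x y + r' <= r -> eball y r' `<=` eball x r.
Proof.
move=> h z yz; apply: le_trans (euclid_triangle y x z) _.
by apply: le_trans h; rewrite lerD2l.
Qed.

Lemma norm_dotv_unit (R : realType) n (e x y : 'rV[R]_n) :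
  dotv e e = 1 -> `|dotv (x - y) e| <= edist x y.
Proof.
move=> e1; rewrite -ler_sqr ?nnegrE ?euclid_ge0// real_normK ?num_real//.
by rewrite sqr_euclid -[leRHS]mulr1 -e1 dotv_CauchySchwarz.
Qed.

Lemma euclid_proj_line (R : realType) n (e x y : 'rV[R]_n) :
  dotv e e = 1 -> edist (proj_line e x) (proj_line e y) = `|dotv (x - y) e|.
Proof.
move=> e1; rewrite /edist /proj_line -scalerBl dotvZl dotvZr e1 mulr1.
by rewrite -dotvBl -expr2 sqrtr_sqr.
Qed.

Lemma dotv2E (R : realType) (u v : 'rV[R]_2) :
  dotv u v = u ord0 ord0 * v ord0 ord0 + u ord0 ord_max * v ord0 ord_max.
Proof.
rewrite /dotv big_ord_recl big_ord1.
by rewrite (_ : lift ord0 ord0 = ord_max)//; apply/val_inj.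
Qed.

Lemma dotv_unit_vec (R : realType) (u : 'rV[R]_2) (t : R) :
  dotv u (unit_vec t) = u ord0 ord0 * cos t + u ord0 ord_max * sin t.
Proof. by rewrite dotv2E !mxE. Qed.

Lemma unit_vec_norm1 (R : realType) (t : R) :
  dotv (unit_vec t) (unit_vec t) = 1.
Proof. by rewrite dotv_unit_vec !mxE -!expr2 cos2Dsin2. Qed.

(** * Hausdorff measure as an outer measure *)

Lemma ediam_ge0 (R : realType) n (E : set 'rV[R]_n) : (0 <= ediam E)%E.
Proof. by rewrite le_max lexx. Qed.

Lemma edist_le_ediam (R : realType) n (E : set 'rV[R]_n) x y :
  E x -> E y -> ((edist x y)%:E <= ediam E)%E.
Proof.
move=> Ex Ey; rewrite le_max; apply/orP; right.
by apply: ereal_sup_ubound; exists x => //; exists y.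
Qed.

Lemma ediam0 (R : realType) n : ediam (@set0 'rV[R]_n) = 0%E.
Proof.
rewrite /ediam (_ : [set _ | _ in _ & _ in _] = set0); last first.
  by apply/seteqP; split => // z [].
by rewrite ereal_sup0 max_l ?leNye.
Qed.

(** Sets of diameter larger than [d] receive infinite weight, so that covering
    by arbitrary sets of weight [gauge d] amounts to covering by sets of
    diameter at most [d]. *)
Definition gauge (R : realType) n (d : R) (E : set 'rV[R]_n) : \bar R :=
  if (ediam E <= d%:E)%E then ediam E else +oo%E.

Lemma gauge_ge0 (R : realType) n (d : R) (E : set 'rV[R]_n) :
  (0 <= gauge d E)%E.
Proof. by rewrite /gauge; case: ifP => // _; exact: ediam_ge0. Qed.

Lemma gauge0 (R : realType) n (d : R) :
  0 < d -> gauge d (@set0 'rV[R]_n) = 0%E.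
Proof. by move=> d0; rewrite /gauge ediam0 lee_fin (ltW d0). Qed.

(* Every subset is declared measurable, so that the covers admitted by the
   outer measure generated by a set function are arbitrary. *)
Local Notation allsets R n :=
  (g_sigma_algebraType [set: set 'rV[R]_n]).

Lemma hausdorff1_premeasureE (R : realType) n (d : R) (E : set 'rV[R]_n) :
  hausdorff1_premeasure d E = mu_ext (gauge d : set (allsets R n) -> \bar R) E.
Proof.
apply/eqP; rewrite eq_le; apply/andP; split; last first.
  apply: ereal_inf_le_tmp => _ [U [EU dU] <-]; exists U.
    by split => // i; exact: sub_sigma_algebra.
  by apply: eq_eseriesr => i _; rewrite /gauge dU.
apply: le_ereal_inf_tmp => _ [U [_ EU] <-].
have [dU|/existsNP[i /negP dU]] := pselect (forall i, (ediam (U i) <= d%:E)%E).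
  apply: ereal_inf_lbound; exists U => //.
  by apply: eq_eseriesr => i _; rewrite /gauge dU.
rewrite (@nneseries_pinfty _ _ _ i) ?leey//.
  by move=> j _; exact: gauge_ge0.
by rewrite /gauge (negbTE dU).
Qed.

Lemma premeasure_ge0 (R : realType) n (d : R) (E : set 'rV[R]_n) :
  (0 <= hausdorff1_premeasure d E)%E.
Proof.
by rewrite hausdorff1_premeasureE; apply: mu_ext_ge0 => X; exact: gauge_ge0.
Qed.

Lemma premeasure0 (R : realType) n (d : R) :
  0 < d -> hausdorff1_premeasure d (@set0 'rV[R]_n) = 0%E.
Proof.
move=> d0; rewrite hausdorff1_premeasureE mu_ext0 ?gauge0// => X.
exact: gauge_ge0.
Qed.

Lemma le_premeasure (R : realType) n (d : R) (E F : set 'rV[R]_n) :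
  E `<=` F -> (hausdorff1_premeasure d E <= hausdorff1_premeasure d F)%E.
Proof. by move=> EF; rewrite !hausdorff1_premeasureE; exact: le_mu_ext. Qed.

Lemma premeasure_sigma_subadditive (R : realType) n (d : R)
    (F : nat -> set 'rV[R]_n) :
  (hausdorff1_premeasure d (\bigcup_i F i) <=
   \sum_(i <oo) hausdorff1_premeasure d (F i))%E.
Proof.
rewrite hausdorff1_premeasureE; apply: le_trans.
  by apply: mu_ext_sigma_subadditive => X; exact: gauge_ge0.
rewrite le_eqVlt; apply/orP; left; apply/eqP; apply: eq_eseriesr => i _.
by rewrite hausdorff1_premeasureE.
Qed.

Lemma premeasure_anti (R : realType) n (d d' : R) (E : set 'rV[R]_n) :
  d <= d' -> (hausdorff1_premeasure d' E <= hausdorff1_premeasure d E)%E.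
Proof.
move=> dd'; apply: ereal_inf_le_tmp => _ [U [EU dU] <-]; exists U => //.
by split => // i; apply: le_trans (dU i) _; rewrite lee_fin.
Qed.

Lemma premeasure_le_hausdorff1 (R : realType) n (d : R) (E : set 'rV[R]_n) :
  0 < d -> (hausdorff1_premeasure d E <= hausdorff1 E)%E.
Proof. by move=> d0; apply: ereal_sup_ubound; exists d. Qed.

Lemma hausdorff1_set0 (R : realType) n : hausdorff1 (@set0 'rV[R]_n) = 0%E.
Proof.
apply/eqP; rewrite eq_le; apply/andP; split.
  by apply: ge_ereal_sup => _ [d /= d0 <-]; rewrite premeasure0.
by rewrite -(@premeasure0 R n 1)//; exact: premeasure_le_hausdorff1.
Qed.

Lemma hausdorff1_ge0 (R : realType) n (E : set 'rV[R]_n) : (0 <= hausdorff1 E)%E.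
Proof.
exact: le_trans (premeasure_ge0 1 E) (premeasure_le_hausdorff1 _ _).
Qed.

Lemma le_hausdorff1 (R : realType) n :
  {homo @hausdorff1 R n : E F / E `<=` F >-> (E <= F)%E}.
Proof.
move=> E F EF; apply: ge_ereal_sup => _ [d /= d0 <-].
exact: le_trans (le_premeasure d EF) (premeasure_le_hausdorff1 _ _).
Qed.

Lemma hausdorff1_sigma_subadditive (R : realType) n :
  sigma_subadditive (@hausdorff1 R n).
Proof.
move=> F; apply: ge_ereal_sup => _ [d /= d0 <-].
apply: le_trans (premeasure_sigma_subadditive d F) _.
apply: lee_nneseries => [i _ _|i _]; first exact: premeasure_ge0.
exact: premeasure_le_hausdorff1.
Qed.

HB.instance Definition _ (R : realType) n := isOuterMeasure.Build
  R 'rV[R]_n (@hausdorff1 R n) (@hausdorff1_set0 R n) (@hausdorff1_ge0 R n)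
  (@le_hausdorff1 R n) (@hausdorff1_sigma_subadditive R n).

Lemma hausdorff1_restr_sigma_subadditive (R : realType) n (K : set 'rV[R]_n) :
  sigma_subadditive (hausdorff1_restr K).
Proof.
move=> F; rewrite /hausdorff1_restr setI_bigcupl.
exact: outer_measure_sigma_subadditive.
Qed.

Lemma le_hausdorff1_restr (R : realType) n (K : set 'rV[R]_n) :
  {homo hausdorff1_restr K : E F / E `<=` F >-> (E <= F)%E}.
Proof. by move=> E F EF; apply: le_outer_measure; exact: setSI. Qed.

Lemma hausdorff1_restr_set0 (R : realType) n (K : set 'rV[R]_n) :
  hausdorff1_restr K set0 = 0%E.
Proof. by rewrite /hausdorff1_restr set0I outer_measure0. Qed.

HB.instance Definition _ (R : realType) n (K : set 'rV[R]_n) :=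
  isOuterMeasure.Build R 'rV[R]_n (hausdorff1_restr K)
  (hausdorff1_restr_set0 K) (fun E => hausdorff1_ge0 (E `&` K))
  (@le_hausdorff1_restr R n K) (@hausdorff1_restr_sigma_subadditive R n K).

Lemma hausdorff1_ediam0 (R : realType) n (E : set 'rV[R]_n) :
  (ediam E <= 0)%E -> hausdorff1 E = 0%E.
Proof.
move=> E0; have {E0}E0 : ediam E = 0%E by apply/eqP; rewrite eq_le E0 ediam_ge0.
apply/eqP; rewrite eq_le hausdorff1_ge0 andbT.
apply: ge_ereal_sup => _ [d /= d0 <-].
pose U (i : nat) : set 'rV[R]_n := if i == 0%N then E else set0.
have U0 i : ediam (U i) = 0%E by case: i => [|i] //=; rewrite ediam0.
apply: ereal_inf_lbound; exists U.
  split; first by move=> x Ex; exists 0%N.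
  by move=> i; rewrite U0 lee_fin ltW.
by apply: eseries0 => i _ _; rewrite U0.
Qed.

(** A set of diameter less than the gap meets at most one of the two pieces, so
    a fine cover of the union splits into covers of the pieces. *)
Lemma premeasure_superadditive (R : realType) n (d g : R) (E F : set 'rV[R]_n) :
  d < g -> 0 < d -> (forall x y, E x -> F y -> g <= edist x y) ->
  (hausdorff1_premeasure d E + hausdorff1_premeasure d F <=
   hausdorff1_premeasure d (E `|` F))%E.
Proof.
move=> dg d0 EF; apply: le_ereal_inf_tmp => _ [U [EFU dU] <-].
pose part (X : set 'rV[R]_n) i := if `[< U i `&` X !=set0 >] then U i else set0.
have ediam_part X i : (ediam (part X i) <= ediam (U i))%E.
  by rewrite /part; case: ifP => // _; rewrite ediam0 ediam_ge0.
have part_cover X : X `<=` E `|` F ->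
    (hausdorff1_premeasure d X <= \sum_(i <oo) ediam (part X i))%E.
  move=> XEF; apply: ereal_inf_lbound; exists (part X) => //; split.
    move=> x Xx; have [i _ Ux] := EFU _ (XEF _ Xx).
    by exists i => //; rewrite /part ifT//; apply/asboolP; exists x.
  by move=> i; exact: le_trans (ediam_part X i) (dU i).
apply: le_trans (leeD (part_cover _ (@subsetUl _ E F))
                      (part_cover _ (@subsetUr _ E F))) _.
rewrite -nneseriesD; last 2 first.
- by move=> i _ _; exact: ediam_ge0.
- by move=> i _ _; exact: ediam_ge0.
apply: lee_nneseries => [i _ _|i _].
  by apply: adde_ge0; exact: ediam_ge0.
rewrite /part; case: asboolP => [[x [Ux Ex]]|_]; last first.
  by rewrite ediam0 add0e; case: ifP => // _; rewrite ediam0 ediam_ge0.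
case: asboolP => [[y [Uy Fy]]|_]; last by rewrite ediam0 adde0.
have := le_trans (edist_le_ediam Ux Uy) (dU i).
by rewrite lee_fin leNgt (lt_le_trans dg (EF _ _ Ex Fy)).
Qed.

Lemma hausdorff1_superadditive (R : realType) n (g : R) (E F : set 'rV[R]_n) :
  0 < g -> (forall x y, E x -> F y -> g <= edist x y) ->
  (hausdorff1 E + hausdorff1 F <= hausdorff1 (E `|` F))%E.
Proof.
move=> g0 EF; have [->|/eqP EFoo] := pselect (hausdorff1 (E `|` F) = +oo%E).
  by rewrite leey.
have EFfin : hausdorff1 (E `|` F) \is a fin_num.
  by rewrite ge0_fin_numE ?hausdorff1_ge0// ltey.
have finl d : 0 < d -> hausdorff1_premeasure d F \is a fin_num.
  move=> d0; rewrite ge0_fin_numE ?premeasure_ge0//.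
  apply: le_lt_trans (premeasure_le_hausdorff1 F d0) _.
  apply: le_lt_trans (le_hausdorff1 (@subsetUr _ E F)) _.
  by rewrite ltey.
have Efin : hausdorff1 E \is a fin_num.
  rewrite ge0_fin_numE ?hausdorff1_ge0//.
  by apply: le_lt_trans (le_hausdorff1 (@subsetUl _ E F)) _; rewrite ltey.
rewrite addeC -leeBrDr//; apply: ge_ereal_sup => _ [d2 /= d2_gt0 <-].
rewrite leeBrDr// addeC -leeBrDr ?finl//.
apply: ge_ereal_sup => _ [d1 /= d1_gt0 <-].
rewrite leeBrDr ?finl//.
pose d := Num.min (g / 2) (Num.min d1 d2).
have d_gt0 : 0 < d by rewrite !lt_min d1_gt0 d2_gt0 divr_gt0.
apply: (@le_trans _ _ (hausdorff1_premeasure d E + hausdorff1_premeasure d F)%E).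
  by apply: leeD; apply: premeasure_anti; rewrite !ge_min lexx ?orbT.
apply: le_trans (premeasure_superadditive _ d_gt0 EF) _.
  rewrite gt_min; apply/orP; left; lra.
exact: premeasure_le_hausdorff1.
Qed.

(** * Support, packings and nets of regular sets *)

Lemma rational_point_near (R : realType) n (x : 'rV[R]_n) (r : R) : 0 < r ->
  exists q : 'rV[rat]_n, edist x (map_mx ratr q) <= r.
Proof.
move=> r0; have e0 : 0 < r / n.+1%:R by rewrite divr_gt0.
have near i : exists q : rat, `|x ord0 i - ratr q| < r / n.+1%:R.
  move: (r / n.+1%:R) e0 => e e0.
  have lt_x : x ord0 i - e < x ord0 i + e by lra.
  have [q] := rat_in_itvoo lt_x; rewrite in_itv /= => /andP[h1 h2]; exists q.
  by rewrite ltr_norml; apply/andP; split; lra.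
have [q xq] := choice near; exists (\row_i q i).
rewrite -ler_sqr ?nnegrE ?euclid_ge0 ?(ltW r0)// sqr_euclid.
apply: (@le_trans _ _ (\sum_(i < n) (r / n.+1%:R) ^+ 2)).
  apply: ler_sum => i _; rewrite !mxE -expr2 -(real_normK (num_real _)).
  by rewrite ler_sqr ?nnegrE ?normr_ge0 ?(ltW e0)// ltW.
rewrite sumr_const card_ord -[leLHS]mulr_natr expr_div_n -mulrA ler_piMr ?sqr_ge0//.
rewrite mulrC ler_pdivrMr ?exprn_gt0// mul1r expr2.
by rewrite -natrM ler_nat; nia.
Qed.

(** Every point outside the support lies in a null ball with rational centre
    and radius [1 / (k + 1)]. *)
Lemma msupport_conull (R : realType) n
    (mu : {outer_measure set 'rV[R]_n -> \bar R}) :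
  mu (~` msupport mu) = 0%E.
Proof.
pose B (z : 'rV[rat]_n * nat) : set 'rV[R]_n :=
  eball (map_mx ratr z.1) (z.2.+1%:R^-1).
pose F (i : nat) : set 'rV[R]_n :=
  if unpickle i is Some z then if mu (B z) == 0%E then B z else set0 else set0.
have F0 i : mu (F i) = 0%E.
  rewrite /F; case: (unpickle i) => [z|]; last by rewrite outer_measure0.
  by case: ifPn => [/eqP//|_]; rewrite outer_measure0.
apply/eqP; rewrite eq_le outer_measure_ge0 andbT.
apply: (@le_trans _ _ (mu (\bigcup_i F i))); last first.
  apply: le_trans (outer_measure_sigma_subadditive mu F) _.
  by rewrite eseries0// => i _ _; rewrite F0.
apply: le_outer_measure => x /existsNP[r /not_implyP[r0 /negP]].
rewrite -leNgt => mur; have mu0 : mu (eball x r) = 0%E.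
  by apply/eqP; rewrite eq_le mur outer_measure_ge0.
have r2 : 0 < r / 2 by rewrite divr_gt0.
pose k := Num.truncn (r / 2)^-1.
have kr : k.+1%:R^-1 <= r / 2.
  rewrite -[leRHS]invrK lef_pV2 ?posrE ?invr_gt0//.
  by rewrite ltW// truncnS_gt.
have [q xq] := @rational_point_near R n x k.+1%:R^-1 ltac:(by rewrite invr_gt0).
exists (pickle (q, k)) => //; rewrite /F pickleK ifT.
  by rewrite /B /eball /= euclidC.
apply/eqP/le_anti; rewrite outer_measure_ge0 andbT -mu0.
apply: le_outer_measure; apply: sub_eball.
by rewrite (splitr r) lerD// (le_trans xq).
Qed.

Lemma le_outer_measure_msupport (R : realType) n
    (mu : {outer_measure set 'rV[R]_n -> \bar R}) (E F : set 'rV[R]_n) :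
  E `&` msupport mu `<=` F -> (mu E <= mu F)%E.
Proof.
move=> EF; rewrite -[leRHS]adde0 -(msupport_conull mu).
apply: le_trans (outer_measureU2 mu _ _); apply: le_outer_measure => x Ex.
by have [Sx|nSx] := pselect (msupport mu x); [left; apply: EF|right].
Qed.

Lemma outer_measure_bigsetU (T : choiceType) X (R : realType)
    (mu : {outer_measure set X -> \bar R}) (s : seq T) (F : T -> set X) :
  (mu (\bigcup_(z in [set` s]) F z) <= \sum_(z <- s) mu (F z))%E.
Proof.
rewrite bigcup_seq; elim: s => [|z s IH].
  by rewrite !big_nil outer_measure0.
rewrite !big_cons; apply: le_trans (outer_measureU2 mu _ _) _.
exact: leeD.
Qed.

(** All that the multiscale argument uses of a regular set: mass bounds for small
    radii, which turn mass into numbers of balls, and superadditivity on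
    separated sets, which bounds the number of disjoint balls. *)
Definition ball_regular (R : realType) n (A r0 : R)
    (mu : set 'rV[R]_n -> \bar R) : Prop :=
  (forall x r, msupport mu x -> 0 < r -> r <= r0 ->
    ((r / A)%:E <= mu (eball x r) <= (A * r)%:E)%E) /\
  (forall g E F, 0 < g -> (forall x y, E x -> F y -> g <= edist x y) ->
    (mu E + mu F <= mu (E `|` F))%E).

(** If the support had diameter [D < c / A], then it would lie in a ball of
    radius [D] around each of its points, and so the total mass would be at
    most [A * D < c]. For [D = 0] the regularity inequality says nothing, but
    then the support is a point, which is null. *)
Lemma AD_regular1_ball_regular (R : realType) n (A c : R) (K : set 'rV[R]_n) :
  0 < A -> 0 < c -> AD_regular1 A K -> (c%:E <= hausdorff1 K)%E ->
  ball_regular A (c / A) (hausdorff1_restr K) /\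
  msupport (hausdorff1_restr K) !=set0.
Proof.
move=> A0 c0 [_ _ adK] cK; set mu := hausdorff1_restr K; set S := msupport mu.
have cmu : (c%:E <= mu setT)%E by rewrite /mu /hausdorff1_restr setTI.
have S0 : S !=set0.
  apply/set0P/eqP => S0.
  have /(le_trans cmu) : (mu setT <= mu set0)%E.
    by apply: (@le_outer_measure_msupport _ _ mu); rewrite -/S S0 setI0.
  by rewrite /mu hausdorff1_restr_set0 lee_fin leNgt c0.
split=> //; split=> [|g E F g0 EF]; last first.
  rewrite /mu /hausdorff1_restr setIUl.
  by apply: (hausdorff1_superadditive g0) => x y [Ex _] [Fy _]; exact: EF.
suff diamS : ((c / A)%:E <= ediam S)%E.
  by move=> x r Sx r0 rc; apply: adK => //; rewrite (le_trans _ diamS)// lee_fin.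
rewrite leNgt; apply/negP => diamS.
have diam_fin : ediam S \is a fin_num.
  by rewrite ge0_fin_numE ?ediam_ge0// (lt_trans diamS)// ltry.
have [D DE] : exists D, ediam S = D%:E by exists (fine (ediam S)); rewrite fineK.
have D0 : 0 <= D by rewrite -lee_fin -DE ediam_ge0.
rewrite DE lte_fin ltr_pdivlMr// in diamS.
have [x Sx] := S0.
have muD : (mu setT <= mu (eball x D `&` S))%E.
  apply: (@le_outer_measure_msupport _ _ mu) => y [_ Sy]; split=> //.
  by rewrite /eball /= -lee_fin -DE edist_le_ediam.
have [D_eq0|D_neq0] := eqVneq D 0.
  have : (mu setT <= 0)%E.
    apply: le_trans muD _; rewrite -(@hausdorff1_ediam0 _ _ S) ?DE ?D_eq0//.
    by apply: le_outer_measure => y [[]].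
  by move/(le_trans cmu); rewrite lee_fin leNgt c0.
have D_gt0 : 0 < D by rewrite lt_def D_neq0.
have /andP[_ muA] := adK x D Sx D_gt0 ltac:(by rewrite -/mu -/S DE).
have := le_trans cmu (le_trans muD (le_trans (le_outer_measure mu _ _
  (@subIsetl _ _ _)) muA)).
by rewrite lee_fin leNgt mulrC diamS.
Qed.

Definition separated (R : realType) n (rho : R) (s : seq 'rV[R]_n) : bool :=
  pairwise (fun y z => rho < edist y z) s.

(** Balls a quarter of the separation in radius stay [rho / 2] apart. *)
Lemma ball_regular_sum_balls (R : realType) n (A r0 rho : R)
    (mu : {outer_measure set 'rV[R]_n -> \bar R}) (s : seq 'rV[R]_n) :
  ball_regular A r0 mu -> 0 < rho -> separated rho s ->
  (\sum_(y <- s) mu (eball y (rho / 4)) <=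
   mu (\bigcup_(y in [set` s]) eball y (rho / 4)))%E.
Proof.
move=> [_ super] rho0; rewrite bigcup_seq; elim: s => [|y s IH].
  by rewrite !big_nil outer_measure_ge0.
rewrite /separated pairwise_cons => /andP[/allP ys /IH {}IH].
rewrite !big_cons; apply: le_trans (leeD2l _ IH) _.
apply: (super (rho / 2)); first by rewrite divr_gt0.
move=> u v yu; rewrite -bigcup_seq => -[z /ys yz zv].
have := euclid_triangle u y z; have := euclid_triangle v u z.
rewrite /eball /= in yu zv; rewrite (euclidC v z); lra.
Qed.

(** Disjoint balls of radius [rho / 4] around the points carry mass at least
    [rho / (4 A)] each, inside a ball of mass at most [2 A t]. *)
Lemma separated_size_le (R : realType) n (A r0 rho t : R)
    (mu : {outer_measure set 'rV[R]_n -> \bar R}) (s : seq 'rV[R]_n) x :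
  ball_regular A r0 mu -> 0 < A -> 0 < rho -> rho <= t -> 2 * t <= r0 ->
  msupport mu x -> separated rho s ->
  (forall y, y \in s -> msupport mu y /\ edist x y <= t) ->
  (size s)%:R <= 8 * A ^+ 2 * (t / rho).
Proof.
move=> reg A0 rho0 rhot tr0 Sx sep sS.
have [bounds _] := reg.
have t0 : 0 < t by exact: lt_le_trans rhot.
have lower : ((\sum_(y <- s) rho / 4 / A)%:E <=
    \sum_(y <- s) mu (eball y (rho / 4)))%E.
  rewrite -sumEFin big_seq [leRHS]big_seq; apply: lee_sum => y /sS[Sy _].
  by have /andP[] := bounds y (rho / 4) Sy ltac:(lra) ltac:(lra).
have upper : (mu (\bigcup_(y in [set` s]) eball y (rho / 4)) <=
    (A * (2 * t))%:E)%E.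
  have /andP[_] := bounds x (2 * t) Sx ltac:(lra) ltac:(lra).
  apply: le_trans; apply: le_outer_measure => z [y /sS[_ xy]].
  by apply: sub_eball; lra.
have := le_trans (le_trans lower (ball_regular_sum_balls reg rho0 sep)) upper.
rewrite lee_fin big_const_seq count_predT iter_addr_0 -[leLHS]mulr_natr.
move=> h; have := ler_wpM2l (ltW (_ : 0 < 4 * A / rho)) h.
rewrite divr_gt0 ?mulr_gt0// => /(_ isT).
have -> : 4 * A / rho * (rho / 4 / A * (size s)%:R) = (size s)%:R.
  by field; rewrite !gt_eqF.
move/le_trans; apply; rewrite le_eqVlt; apply/orP; left; apply/eqP.
by field; rewrite gt_eqF.
Qed.

(** A separated family of largest size is a net: its balls of radius [rho]
    cover the support inside the ball of radius [t], whence it has at least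
    [t / (A^2 rho)] points. *)
Lemma ball_regular_net (R : realType) n (A r0 rho t : R)
    (mu : {outer_measure set 'rV[R]_n -> \bar R}) x :
  ball_regular A r0 mu -> 0 < A -> 0 < rho -> rho <= t -> 2 * t <= r0 ->
  msupport mu x ->
  exists s : seq 'rV[R]_n, [/\ separated rho s,
    forall y, y \in s -> msupport mu y /\ edist x y <= t &
    t / (A ^+ 2 * rho) <= (size s)%:R].
Proof.
move=> reg A0 rho0 rhot tr0 Sx; have [bounds _] := reg.
have t0 : 0 < t by exact: lt_le_trans rhot.
pose good (s : seq 'rV[R]_n) := separated rho s /\
  forall y, y \in s -> msupport mu y /\ edist x y <= t.
pose P m := `[< exists2 s, size s = m & good s >].
have exP : exists m, P m by exists 0%N; apply/asboolP; exists [::].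
have ubP m : P m -> (m <= Num.truncn (8 * A ^+ 2 * (t / rho)))%N.
  move=> /asboolP[s <- [sep sS]].
  have sz := separated_size_le reg A0 rho0 rhot tr0 Sx sep sS.
  by rewrite truncn_ge_nat// (le_trans _ sz).
case: (ex_maxnP exP ubP) => m /asboolP[s sm [sep sS]] maxm.
exists s; split => //.
have cover : eball x t `&` msupport mu `<=` \bigcup_(y in [set` s]) eball y rho.
  move=> z [xz Sz]; apply: contrapT => nz.
  suff : P m.+1 by move/maxm; rewrite ltnn.
  apply/asboolP; exists (z :: s); first by rewrite /= sm.
  split; last by move=> y; rewrite inE => /orP[/eqP ->//|/sS].
  rewrite /separated pairwise_cons; apply/andP; split => //.
  apply/allP => y ys; rewrite ltNge; apply/negP => zy.
  by apply: nz; exists y => //; rewrite /eball /= euclidC.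
have /andP[muxt _] := bounds x t Sx t0 ltac:(lra).
have : ((t / A)%:E <= (\sum_(y <- s) A * rho)%:E)%E.
  apply: (le_trans muxt); apply: le_trans (le_outer_measure_msupport cover) _.
  apply: le_trans (outer_measure_bigsetU mu s (fun y => eball y rho)) _.
  rewrite -sumEFin big_seq [leRHS]big_seq; apply: lee_sum => y /sS[Sy _].
  by have /andP[] := bounds y rho Sy rho0 ltac:(lra).
rewrite lee_fin big_const_seq count_predT iter_addr_0 -[leRHS]mulr_natr.
rewrite ler_pdivrMr// ler_pdivrMr ?mulr_gt0 ?exprn_gt0//.
by move/le_trans; apply; rewrite le_eqVlt; apply/orP; left; apply/eqP; ring.
Qed.

(** * Directions almost orthogonal to a vector *)

(** Concavity of the sine on [[0, pi/2]], through its slopes on both sides of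
    [x]: the mean slope over [[0, x]] dominates the one over [[x, pi/2]]. *)
Lemma sin_ge_chord (R : realType) (x : R) :
  0 <= x -> x <= pi / 2 -> x <= pi / 2 * sin x.
Proof.
move=> x0 xpi; have pi0 := pi_gt0 R.
have [->|xN0] := eqVneq x 0; first by rewrite sin0 mulr0.
have [->|xNpi] := eqVneq x (pi / 2); first by rewrite sin_pihalf mulr1.
have lt0x : 0 < x by rewrite lt_def xN0.
have ltxpi : x < pi / 2 by rewrite lt_neqAle xNpi.
have dsin (y : R) : is_derive y 1 (@sin R) (cos y) by exact: is_derive_sin.
have csin (a b : R) : {within `[a, b], continuous (@sin R)}.
  by apply: continuous_subspaceT => y; exact: continuous_sin.
have [c1] := MVT lt0x (fun y _ => dsin y) (csin 0 x).
rewrite in_itv /= => /andP[c10 c1x]; rewrite sin0 !subr0 => e1.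
have [c2] := MVT ltxpi (fun y _ => dsin y) (csin x (pi / 2)).
rewrite in_itv /= => /andP[c2x c2pi]; rewrite sin_pihalf => e2.
have cos21 : cos c2 <= cos c1.
  rewrite ltW// ltr_cos ?in_itv /= ?(lt_trans c1x)//; apply/andP; split; lra.
have : (1 - sin x) * x <= (pi / 2 - x) * sin x.
  rewrite e2 [X in _ <= _ * X]e1 mulrAC mulrA mulrAC ler_wpM2r// mulrC.
  by rewrite ler_wpM2l ?subr_ge0.
lra.
Qed.

Lemma norm_sin_addn_pihalf (R : realType) (x : R) (a : nat) :
  `|sin (x + a%:R * (pi / 2))| = if odd a then `|cos x| else `|sin x|.
Proof.
suff : forall b,
    `|sin (x + b%:R * (pi / 2))| = (if odd b then `|cos x| else `|sin x|) /\
    `|cos (x + b%:R * (pi / 2))| = (if odd b then `|sin x| else `|cos x|).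
  by move=> h; have [-> _] := h a.
elim=> [|b [IHs IHc]]; first by rewrite mul0r addr0.
rewrite -natr1 mulrDl mul1r addrA sinDpihalf cosDpihalf normrN IHs IHc /=.
by case: (odd b).
Qed.

(** Up to quarter turns the angle is [pi / 2 * (b / q)] with [b < q] the residue
    of [u], and the sine becomes a sine or a cosine; the chord bounds the former
    by [b / q] and the latter by [(q - b) / q]. *)
Lemma norm_sin_grid (R : realType) (q u : nat) : (0 < q)%N ->
  (u %% q)%:R / q%:R <= `|sin (pi / 2 * (u%:R / q%:R))| :> R \/
  (q - u %% q)%:R / q%:R <= `|sin (pi / 2 * (u%:R / q%:R))| :> R.
Proof.
move=> q0; have q0R : 0 < q%:R :> R by rewrite ltr0n.
set b := (u %% q)%N; have bq : (b < q)%N by rewrite ltn_mod.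
have -> : pi / 2 * (u%:R / q%:R) =
    pi / 2 * (b%:R / q%:R) + (u %/ q)%:R * (pi / 2) :> R.
  rewrite [in LHS](divn_eq u q) -/b natrD natrM.
  by field; rewrite gt_eqF.
have grid c : (c <= q)%N -> c%:R / q%:R <= sin (pi / 2 * (c%:R / q%:R)) :> R.
  move=> cq; have pi2 : 0 < pi / 2 :> R by rewrite divr_gt0 ?pi_gt0.
  have c1 : c%:R / q%:R <= 1 :> R by rewrite ler_pdivrMr// mul1r ler_nat.
  have c0 : 0 <= c%:R / q%:R :> R by rewrite divr_ge0.
  rewrite -(ler_pM2l pi2); apply: sin_ge_chord; first exact: mulr_ge0 (ltW _) _.
  by rewrite -[leRHS]mulr1 ler_pM2l.
rewrite norm_sin_addn_pihalf; case: ifP => _; [right|left]; last first.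
  by rewrite (le_trans (grid b (ltnW bq)))// ler_norm.
apply: le_trans (grid _ (leq_subr _ _)) _.
rewrite natrB ?(ltnW bq)// mulrBl divff ?gt_eqF// mulrBr mulr1.
by rewrite addrC sinDpihalf cosN ler_norm.
Qed.

(** Rotating a quarter turn, the vector [(e x f) v] becomes [<v,e> f - <v,f> e]
    for unit vectors [e] and [f], and [e x f] is the sine of their angle. *)
Lemma sin_angle_le (R : realType) (v : 'rV[R]_2) (x y eta : R) :
  `|dotv v (unit_vec x)| <= eta -> `|dotv v (unit_vec y)| <= eta ->
  `|sin (x - y)| * edist v 0 <= 2 * eta.
Proof.
set a := dotv v (unit_vec x); set b := dotv v (unit_vec y) => ax by_.
have eta0 : 0 <= eta by exact: le_trans ax.
rewrite -ler_sqr ?nnegrE ?mulr_ge0 ?euclid_ge0//.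
rewrite exprMn sqr_euclid subr0 real_normK ?num_real//.
have -> : sin (x - y) ^+ 2 * dotv v v =
    a ^+ 2 + b ^+ 2 - 2 * (a * b) * cos (x - y).
  transitivity (a ^+ 2 * (cos y ^+ 2 + sin y ^+ 2)
    + b ^+ 2 * (cos x ^+ 2 + sin x ^+ 2) - 2 * (a * b) * cos (x - y)); last first.
    by rewrite !cos2Dsin2 !mulr1.
  by rewrite /a /b !dotv_unit_vec dotv2E sinB cosB; ring.
have : a ^+ 2 <= eta ^+ 2 by rewrite -(real_normK (num_real a)) ler_sqr ?nnegrE.
have : b ^+ 2 <= eta ^+ 2 by rewrite -(real_normK (num_real b)) ler_sqr ?nnegrE.
have : `|a * b * cos (x - y)| <= eta ^+ 2.
  rewrite normrM -[leRHS]mulr1 ler_pM// ?cos_max// normrM expr2.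
  by rewrite ler_pM.
rewrite ler_norml => /andP[h _]; lra.
Qed.
Definition direction (R : realType) (p k : nat) : 'rV[R]_2 :=
  unit_vec (2 * pi * k%:R / p%:R).

Lemma direction_norm1 (R : realType) p k :
  dotv (direction R p k) (direction R p k) = 1.
Proof. exact: unit_vec_norm1. Qed.

(** An index difference [u] with residue close to [0] or to [q] modulo [q] is a
    multiple of [q], between [- 4 q] and [4 q], up to an error of at most [N]; the
    shift by [N + 4 q] makes both parts natural numbers. *)
Lemma grid_residue (q N k l u : nat) : (0 < q)%N ->
  (u < 4 * q)%N -> (l = k + u \/ k = l + u)%N ->
  (u %% q <= N \/ q - u %% q <= N)%N ->
  exists a c, [/\ (a < 9)%N, (c < 2 * N + 1)%N &
    (l + (N + 4 * q) = k + q * a + c)%N].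
Proof.
move=> q0 u4 kl near; have ub := divn_eq u q; have bq := ltn_pmod u q0.
set a := (u %/ q)%N in ub *; set b := (u %% q)%N in ub bq near *.
have a4 : (a < 4)%N by rewrite ltn_divLR.
case: kl => kl; case: near => near.
- by exists (a + 4)%N, (b + N)%N; split; nia.
- by exists (a + 5)%N, (N - (q - b))%N; split; nia.
- exists (4 - a)%N, (N - b)%N; split; [lia|lia|].
  by case: a a4 ub => [|[|[|[|//]]]] _ ub; lia.
- exists (3 - a)%N, (N + (q - b))%N; split; [lia|lia|].
  by case: a a4 ub => [|[|[|[|//]]]] _ ub; lia.
Qed.

(** Two directions almost orthogonal to [v] are almost parallel, so all of them
    lie close to translates by quarter turns of any given one. *)
Lemma card_directions_le (R : realType) (q : nat) (v : 'rV[R]_2) (eta : R) :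
  (0 < q)%N -> 0 <= eta -> 0 < edist v 0 ->
  #|[set k : 'I_(4 * q) | `|dotv v (direction R (4 * q) k)| <= eta]%SET|%:R <=
    9 * ((4 * q)%:R * (eta / edist v 0) + 1) :> R.
Proof.
move=> q0 eta0 d0; have q0R : 0 < q%:R :> R by rewrite ltr0n.
set L := (finset.finset _); set d := edist v 0 in d0 *.
have [->|[k0]] := set_0Vmem L.
  by rewrite cards0 mulr_ge0// addr_ge0// mulr_ge0// divr_ge0// ltW.
rewrite inE => k0L.
pose N := Num.truncn (2 * eta / d * q%:R).
have N0 : 0 <= 2 * eta / d * q%:R by rewrite mulr_ge0// divr_ge0 ?mulr_ge0// ltW.
have truncN (c : nat) : c%:R / q%:R <= 2 * eta / d -> (c <= N)%N.
  by move=> h; rewrite truncn_ge_nat// -ler_pdivrMr.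
(* The multiple of [q] and the error determine the index; [k0] is a dummy value
   for the pairs that lead out of range. *)
pose f (z : 'I_9 * 'I_(2 * N + 1)) : 'I_(4 * q) :=
  odflt k0 (insub (k0 + q * z.1 + z.2 - (N + 4 * q))%N).
have Lf : L \subset [set f z | z : 'I_9 * 'I_(2 * N + 1)]%SET.
  apply/fintype.subsetP => l; rewrite inE => lL.
  have sinle (k k' : 'I_(4 * q)) :
      `|dotv v (direction R (4 * q) k)| <= eta ->
      `|dotv v (direction R (4 * q) k')| <= eta -> (k' <= k)%N ->
      `|sin (pi / 2 * ((k - k')%:R / q%:R))| <= 2 * eta / d.
    move=> h h' kk; rewrite ler_pdivlMr//; apply: le_trans (sin_angle_le h h').
    rewrite le_eqVlt; apply/orP; left; apply/eqP; congr (`|sin _| * _).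
    by rewrite natrB// natrM; field; rewrite gt_eqF.
  have near : exists u, [/\ (u < 4 * q)%N, (l = k0 + u :> nat \/ k0 = l + u :> nat)%N &
      (u %% q <= N \/ q - u %% q <= N)%N].
    have [k0l|/ltnW lk0] := leqP k0 l.
      exists (l - k0)%N; split; first by have := ltn_ord l; lia.
        by left; lia.
      have h := sinle _ _ lL k0L k0l.
      by have [h'|h'] := norm_sin_grid R (l - k0) q0; [left|right];
        apply: truncN; exact: le_trans h' h.
    exists (k0 - l)%N; split; first by have := ltn_ord k0; lia.
      by right; lia.
    have h := sinle _ _ k0L lL lk0.
    by have [h'|h'] := norm_sin_grid R (k0 - l) q0; [left|right];
      apply: truncN; exact: le_trans h' h.
  have [u [u4 kl un]] := near.
  have [a [c [a9 cN e]]] := grid_residue q0 u4 kl un.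
  apply/imsetP; exists (Ordinal a9, Ordinal cN) => //.
  by rewrite /f /= -e addnK valK.
have cardL : (#|L| <= 9 * (2 * N + 1))%N.
  apply: leq_trans (subset_leq_card Lf) _.
  by apply: leq_trans (leq_imset_card _ _) _; rewrite card_prod !card_ord.
have NR : N%:R <= 2 * eta / d * q%:R by rewrite -truncn_ge_nat.
apply: (@le_trans _ _ (9 * (2 * N + 1))%:R); first by rewrite ler_nat.
rewrite natrM ler_wpM2l// natrD lerD2r.
have -> : (4 * q)%:R * (eta / d) = 2 * (2 * eta / d * q%:R).
  by rewrite natrM; field; rewrite gt_eqF.
by rewrite natrM ler_wpM2l.
Qed.

(** At scale [2^j rho] the proportion of directions that bring [v] within
    [4 rho] of the orthogonal complement is of the order of [2^-j]; the sum over
    [j] replaces the choice of the scale of [v]. *)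
Lemma card_directions_dyadic (R : realType) (J : nat) (v : 'rV[R]_2) (rho : R) :
  0 < rho -> edist v 0 <= 2 ^+ J * rho ->
  #|[set k : 'I_(4 * 2 ^ J) |
      `|dotv v (direction R (4 * 2 ^ J) k)| <= 4 * rho]%SET|%:R <=
  81 * (4 * 2 ^ J)%:R *
    \sum_(j < J.+1) (2 ^+ j)^-1 * (edist v 0 <= 2 ^+ j * rho)%R%:R :> R.
Proof.
move=> rho0 vJ; set d := edist v 0 in vJ *.
have ex_j : exists j, d <= 2 ^+ j * rho by exists J.
case: (ex_minnP ex_j) => j dj minj.
have jJ : (j < J.+1)%N by rewrite ltnS minj.
set p := (4 * 2 ^ J)%N; set S := (finset.finset _).
apply: (@le_trans _ _ (81 * p%:R * (2 ^+ j)^-1)); last first.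
  rewrite ler_wpM2l ?mulr_ge0//.
  rewrite (bigD1 (Ordinal jJ))//= dj mulr1 lerDl.
  by apply: sumr_ge0 => i _; rewrite mulr_ge0 ?invr_ge0 ?exprn_ge0.
(* The least such [j] is the scale of [v]; for [j = 0] all directions count. *)
case: j dj minj jJ => [|j] dj minj jJ.
  rewrite expr0 invr1 mulr1.
  apply: (@le_trans _ _ p%:R); last by rewrite ler_peMl// ler1n.
  by rewrite ler_nat -[leqRHS]card_ord max_card.
have dlt : 2 ^+ j * rho < d.
  by rewrite ltNge; apply/negP => /minj; rewrite ltnn.
have j0 : 0 < 2 ^+ j :> R by rewrite exprn_gt0.
have d0 : 0 < d by rewrite (lt_trans _ dlt)// mulr_gt0.
have q0 : (0 < 2 ^ J)%N by rewrite expn_gt0.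
have := @card_directions_le R (2 ^ J) v (4 * rho) q0 (mulr_ge0 (ler0n R 4) (ltW rho0)) d0.
rewrite -/p -/S -/d => /le_trans; apply.
(* As [|v| > 2 ^ j rho], the ratio [4 rho / |v|] is less than [8 / 2 ^ j.+1],
   and the additive constant is at most [p / 2 ^ j.+1]. *)
have -> : 81 * p%:R * (2 ^+ j.+1)^-1 =
    9 * (p%:R * (8 * (2 ^+ j.+1)^-1) + p%:R * (2 ^+ j.+1)^-1) :> R by ring.
rewrite ler_wpM2l// lerD//.
  rewrite ler_wpM2l// ler_pdivrMr// exprS invfM.
  have -> : 8 * (2^-1 * (2 ^+ j)^-1) * d = 4 * (d / 2 ^+ j) :> R.
    by field; rewrite gt_eqF.
  by rewrite ler_wpM2l// ler_pdivlMr// mulrC ltW.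
rewrite ler_pdivlMr ?exprn_gt0// mul1r -natrX ler_nat.
by rewrite (leq_trans (leq_pexp2l _ (_ : j.+1 <= J)%N))// /p leq_pmull.
Qed.

(** * One scale of the multiscale estimate *)

Lemma sumr_seq_gt0 (R : realType) (I : eqType) (r : seq I) (F : I -> R) :
  (0 < size r)%N -> (forall i, i \in r -> 0 < F i) -> 0 < \sum_(i <- r) F i.
Proof.
case: r => [//|i r] _ F0; rewrite big_cons ltr_wpDr ?F0 ?mem_head//.
rewrite big_seq; apply: sumr_ge0 => j jr.
by rewrite ltW// F0// in_cons jr orbT.
Qed.

(** Jensen's inequality for the logarithm, from [ln x <= x - 1]. *)
Lemma sum_ln_le (R : realType) (I : eqType) (r : seq I) (F : I -> R) :
  (forall i, i \in r -> 0 < F i) ->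
  \sum_(i <- r) ln (F i) <=
    (size r)%:R * ln ((\sum_(i <- r) F i) / (size r)%:R).
Proof.
case: r => [|i0 r] F0; first by rewrite !big_nil mul0r.
set s := i0 :: r in F0 *; set n := (size s)%:R.
have n0 : 0 < n by rewrite ltr0n.
pose m := (\sum_(i <- s) F i) / n.
have sum0 : 0 < \sum_(i <- s) F i by exact: sumr_seq_gt0.
have m0 : 0 < m by rewrite divr_gt0.
have step : \sum_(i <- s) ln (F i) <= \sum_(i <- s) (ln m + (F i / m - 1)).
  rewrite big_seq [leRHS]big_seq; apply: ler_sum => i /F0 Fi.
  have Fm : 0 < F i / m by rewrite divr_gt0.
  rewrite -lerBlDl -ln_div ?posrE//.
  by rewrite -[X in ln X](subrKC 1) le_ln1Dx// ltrBrDl subrr.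
apply: le_trans step _; rewrite big_split /= sumrB -mulr_suml.
rewrite !big_const_seq !count_predT !iter_addr_0.
have -> : 1 *+ size s = n by [].
have -> : (\sum_(i <- s) F i) / m = n.
  by rewrite /m; field; rewrite !gt_eqF.
by rewrite subrr addr0 -/m -[leLHS]mulr_natl.
Qed.

(** Stating the estimates for the size [m] of an arbitrary finite cover keeps
    them free of the infinite value of a covering number. *)
Definition proj_covered (R : realType) n (E : set 'rV[R]_n) (e : 'rV[R]_n)
    (delta : R) (m : nat) : Prop :=
  exists c : 'I_m -> 'rV[R]_n,
    proj_line e @` E `<=` \bigcup_i eball (c i) delta.

Lemma proj_covered_gt0 (R : realType) n (E : set 'rV[R]_n) e (delta : R) m :
  E !=set0 -> proj_covered E e delta m -> (0 < m)%N.
Proof.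
move=> [x Ex] [c Ec]; have [i _ _] := Ec _ (imageP (proj_line e) Ex).
exact: leq_ltn_trans (ltn_ord i).
Qed.

(** Two pieces of radius [rho] whose projections meet a common ball of radius at
    most [rho] have centres with projections at distance at most [4 rho]. *)
Definition fibre_mult (R : realType) n (s : seq 'rV[R]_n) (e : 'rV[R]_n)
    (rho : R) (y : 'rV[R]_n) : nat :=
  count (fun z => `|dotv (y - z) e| <= 4 * rho) s.

Lemma fibre_mult_gt0 (R : realType) n (s : seq 'rV[R]_n) e (rho : R) y :
  0 < rho -> y \in s -> (0 < fibre_mult s e rho y)%N.
Proof.
move=> rho0 ys; rewrite -has_count; apply/hasP; exists y => //.
by rewrite subrr -(scale0r (0 : 'rV[R]_n)) dotvZl mul0r normr0 mulr_ge0// ltW.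
Qed.

(** Each ball of the cover is counted once for every piece it meets, and the
    pieces it meets have projections so close that each of them has multiplicity
    at least their number. *)
Lemma proj_covered_pieces (R : realType) n (K E : set 'rV[R]_n) (e : 'rV[R]_n)
    (delta rho : R) (s : seq 'rV[R]_n) (m : nat) :
  dotv e e = 1 -> delta <= rho -> 0 < rho ->
  (forall y, y \in s -> K `&` eball y rho `<=` E) ->
  proj_covered E e delta m ->
  exists N : 'rV[R]_n -> nat,
    (forall y, y \in s -> proj_covered (K `&` eball y rho) e delta (N y)) /\
    \sum_(y <- s) (N y)%:R / (fibre_mult s e rho y)%:R <= m%:R :> R.
Proof.
move=> e1 dr rho0 sE [c Ec].
pose meets y (j : 'I_m) : bool :=
  `[< exists2 u, (K `&` eball y rho) u & eball (c j) delta (proj_line e u) >].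
exists (fun y => #|meets y|); split=> [y ys|].
  exists (fun i => c (enum_val i)) => _ [u Ku <-].
  have [j _ cj] := Ec _ (imageP (proj_line e) (sE y ys u Ku)).
  have jy : j \in meets y by apply/asboolP; exists u.
  by exists (enum_rank_in jy j) => //; rewrite enum_rankK_in.
have close y z j : meets y j -> meets z j -> `|dotv (y - z) e| <= 4 * rho.
  move=> /asboolP[u [_ yu] cu] /asboolP[v [_ zv] cv].
  have uv : `|dotv (u - v) e| <= 2 * rho.
    rewrite -euclid_proj_line//; apply: le_trans (euclid_triangle (c j) _ _) _.
    rewrite /eball /= in cu cv; rewrite euclidC; lra.
  have yu' := le_trans (norm_dotv_unit y u e1) yu.
  have vz' : `|dotv (v - z) e| <= rho.
    by apply: le_trans (norm_dotv_unit v z e1) _; rewrite euclidC.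
  have -> : y - z = (y - u) + (u - v) + (v - z) by rewrite !addrA !subrK.
  rewrite (dotvDl _ (v - z)) (dotvDl (y - u)).
  have := ler_normD (dotv (y - u) e) (dotv (u - v) e).
  have := ler_normD (dotv (y - u) e + dotv (u - v) e) (dotv (v - z) e).
  lra.
have -> : \sum_(y <- s) #|meets y|%:R / (fibre_mult s e rho y)%:R =
    \sum_(j < m) \sum_(y <- s | meets y j) (fibre_mult s e rho y)%:R^-1 :> R.
  rewrite [RHS](exchange_big_dep xpredT) //=; apply: eq_bigr => y _.
  by rewrite sumr_const mulr_natl.
rewrite -[leRHS](_ : \sum_(j < m) 1 = _); last by rewrite sumr_const card_ord.
apply: ler_sum => j _; rewrite -big_filter; set sj := seq.filter _ s.
have [->|[y0 y0s]] : sj = [::] \/ exists y0, y0 \in sj.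
- by case: (sj) => [|y0 t]; [left|right; exists y0; rewrite mem_head].
- by rewrite big_nil.
have sj0 : 0 < (size sj)%:R :> R.
  by rewrite ltr0n lt0n; apply: contraTneq y0s => /size0nil ->.
apply: (@le_trans _ _ (\sum_(y <- sj) (size sj)%:R^-1)); last first.
  by rewrite big_const_seq count_predT iter_addr_0 -[leLHS]mulr_natl divff ?gt_eqF.
rewrite big_seq [leRHS]big_seq; apply: ler_sum => y.
rewrite mem_filter => /andP[yj ys].
rewrite lef_pV2 ?posrE ?ltr0n ?fibre_mult_gt0//.
  rewrite ler_nat size_filter; apply: sub_count => z /=; exact: close.
by rewrite -(ltr0n R).
Qed.

(** Here [648 = 81 * 8] is the product of the constants of the angular and of the
    packing estimate. *)
Definition mean_mult_bound (R : realType) (A : R) (J : nat) : R :=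
  648 * A ^+ 2 * J.+1%:R.

Lemma mean_mult_bound_gt0 (R : realType) (A : R) (J : nat) :
  0 < A -> 0 < mean_mult_bound A J.
Proof.
move=> A0; apply: mulr_gt0; last by rewrite ltr0n.
by apply: mulr_gt0; [rewrite ltr0n|exact: exprn_gt0].
Qed.

(** By the angular estimate a pair at distance about [2^j rho] contributes about
    [2^-j p], and by packing there are about [2^j] such pairs: each of the
    scales [j <= J] contributes the same amount. *)
Lemma sum_fibre_mult_le (R : realType) (A r0 rho : R) (J p : nat)
    (mu : {outer_measure set 'rV[R]_2 -> \bar R}) (s : seq 'rV[R]_2) y :
  p = (4 * 2 ^ J)%N -> ball_regular A r0 mu -> 0 < A -> 0 < rho ->
  2 * (2 ^+ J * rho) <= r0 ->
  separated rho s -> (forall z, z \in s -> msupport mu z) ->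
  (forall z, z \in s -> edist y z <= 2 ^+ J * rho) -> msupport mu y ->
  \sum_(k < p) (fibre_mult s (direction R p k) rho y)%:R <=
    p%:R * mean_mult_bound A J.
Proof.
move=> pE reg A0 rho0 Jr0 sep sS sy Sy.
have edist_sub0 z : edist (y - z) 0 = edist y z by rewrite /edist subr0.
have -> : \sum_(k < p) (fibre_mult s (direction R p k) rho y)%:R =
    \sum_(z <- s) #|[set k : 'I_p |
       `|dotv (y - z) (direction R p k)| <= 4 * rho]%SET|%:R :> R.
  rewrite -!natr_sum; congr _%:R.
  transitivity (\sum_(z <- s) \sum_(k < p)
      (`|dotv (y - z) (direction R p k)| <= 4 * rho)%R)%N.
    rewrite exchange_big; apply: eq_bigr => k _.
    by rewrite /fibre_mult -sum1_count [LHS]big_mkcond; apply: eq_bigr => z _; case: ifP.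
  apply: eq_bigr => z _; rewrite -sum1_card [RHS]big_mkcond.
  by apply: eq_bigr => k _; rewrite inE; case: ifP.
apply: (@le_trans _ _ (\sum_(z <- s) 81 * p%:R * \sum_(j < J.+1)
    (2 ^+ j)^-1 * (edist y z <= 2 ^+ j * rho)%R%:R)).
  rewrite big_seq [leRHS]big_seq; apply: ler_sum => z zs.
  rewrite -edist_sub0 pE; apply: card_directions_dyadic => //.
  by rewrite edist_sub0 sy.
rewrite -mulr_sumr exchange_big /=.
apply: (@le_trans _ _ (81 * p%:R * \sum_(j < J.+1) 8 * A ^+ 2)); last first.
  rewrite sumr_const card_ord -[X in _ * X]mulr_natr /mean_mult_bound le_eqVlt; apply/orP; left.
  by apply/eqP; ring.
rewrite ler_wpM2l ?mulr_ge0//; apply: ler_sum => j _.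
have j0 : 0 < 2 ^+ j :> R by rewrite exprn_gt0.
rewrite -mulr_sumr mulrC ler_pdivrMr//.
have -> : \sum_(z <- s) (edist y z <= 2 ^+ j * rho)%R%:R =
    (size [seq z <- s | edist y z <= 2 ^+ j * rho])%:R :> R.
  rewrite size_filter -sum1_count natr_sum [RHS]big_mkcond.
  by apply: eq_bigr => z _; case: ifP.
have -> : 8 * A ^+ 2 * 2 ^+ j = 8 * A ^+ 2 * (2 ^+ j * rho / rho).
  by rewrite mulfK ?gt_eqF.
apply: (separated_size_le reg A0 rho0 _ _ Sy).
- by rewrite ler_peMl ?(ltW rho0)// exprn_ege1// ler1n.
- apply: le_trans Jr0; rewrite ler_wpM2l// ler_wpM2r ?(ltW rho0)//.
  by rewrite ler_weXn2l ?ler1n// -ltnS.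
- exact: (subseq_pairwise (filter_subseq _ _) sep).
- by move=> z; rewrite mem_filter => /andP[yz zs]; split=> //; exact: sS.
Qed.

(** * Iterating over the scales *)

Lemma proj_covered_sub (R : realType) n (E F : set 'rV[R]_n) e (delta : R) m :
  F `<=` E -> proj_covered E e delta m -> proj_covered F e delta m.
Proof.
move=> FE [c Ec]; exists c => _ [x Fx <-].
by apply: Ec; exists x => //; exact: FE.
Qed.

Lemma ball_regular_ball_neq0 (R : realType) n (A r0 r : R) (K : set 'rV[R]_n) x :
  ball_regular A r0 (hausdorff1_restr K) -> 0 < A -> 0 < r -> r <= r0 ->
  msupport (hausdorff1_restr K) x -> K `&` eball x r !=set0.
Proof.
move=> [bounds _] A0 lt0r rr0 Sx; apply/set0P/eqP => K0.
have /andP[+ _] := bounds x r Sx lt0r rr0.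
rewrite /hausdorff1_restr setIC K0 hausdorff1_set0 lee_fin leNgt.
by rewrite divr_gt0.
Qed.

(** The average over the directions of the logarithm of the covering numbers
    grows at least by this much when the scale is divided by [2 ^ J]: the
    logarithm of the size of a net minus that of the average multiplicity. *)
Definition scale_gain (R : realType) (A : R) (J : nat) : R :=
  ln (2 ^+ J / (2 * A ^+ 2)) - ln (mean_mult_bound A J).

(** The induction passes from the ball of centre [x] and radius [r] to the balls
    of radius [r / 2 ^ J] around the points of a net of the concentric ball of
    radius [r / 2], at the same final scale [delta]. The same [p] directions are
    used at every step, which is why the logarithms, and not the covering numbers
    themselves, are summed over the directions. *)
Lemma sum_ln_proj_covered_ge (R : realType) (A r0 delta : R) (J p : nat)
    (K : set 'rV[R]_2) :
  p = (4 * 2 ^ J)%N ->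
  ball_regular A r0 (hausdorff1_restr K) -> 0 < A -> (0 < J)%N -> 0 < delta ->
  forall n r x (N : 'I_p -> nat),
  2 * r <= r0 -> delta * 2 ^+ (J * n) <= r ->
  msupport (hausdorff1_restr K) x ->
  (forall k : 'I_p,
     proj_covered (K `&` eball x r) (direction R p k) delta (N k)) ->
  n%:R * p%:R * scale_gain A J <=
    \sum_(k < p) ln (N k)%:R :> R.
Proof.
move=> pE reg A0 J0 delta0.
have covered_gt0 r x k m : 0 < r -> r <= r0 ->
    msupport (hausdorff1_restr K) x ->
    proj_covered (K `&` eball x r) (direction R p k) delta m -> (0 < m)%N.
  move=> lt0r rr0 Sx; apply: proj_covered_gt0.
  exact: ball_regular_ball_neq0 reg A0 lt0r rr0 Sx.
elim=> [|n IH] r x N rr0 delta_r Sx cov.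
  rewrite !mul0r; apply: sumr_ge0 => k _.
  rewrite muln0 expr0 mulr1 in delta_r.
  by rewrite ln_ge0// ler1n (covered_gt0 _ _ _ _ _ _ Sx (cov k))//; lra.
have twoJ : 0 < 2 ^+ J :> R by rewrite exprn_gt0.
have [rho rE] : exists rho, r = 2 ^+ J * rho.
  by exists (r / 2 ^+ J); field; rewrite gt_eqF.
have delta_rho : delta * 2 ^+ (J * n) <= rho.
  rewrite -(ler_pM2l twoJ) -rE; apply: le_trans delta_r.
  by rewrite mulnS exprD mulrCA.
have le_delta_rho : delta <= rho.
  apply: le_trans delta_rho; rewrite ler_peMr ?(ltW delta0)//.
  by rewrite exprn_ege1// ler1n.
have rho0 : 0 < rho by exact: lt_le_trans le_delta_rho.
have two_rho : 2 * rho <= r.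
  rewrite rE ler_wpM2r ?(ltW rho0)//.
  by rewrite -[leLHS]expr1 ler_weXn2l// ler1n.
have [s [sep sS sM]] := @ball_regular_net R 2 A r0 rho (r / 2) _ x reg A0 rho0
  ltac:(lra) ltac:(lra) Sx.
have s_in y : y \in s -> K `&` eball y rho `<=` K `&` eball x r.
  by move=> /sS[_ xy]; apply: setIS; apply: sub_eball; lra.
have [Nk Nk_spec] := choice (fun k : 'I_p => proj_covered_pieces
  (direction_norm1 R p k) le_delta_rho rho0 s_in (cov k)).
set M := size s in sM.
have M_ge : 2 ^+ J / (2 * A ^+ 2) <= M%:R.
  apply: le_trans sM; rewrite rE le_eqVlt; apply/orP; left; apply/eqP.
  by field; rewrite !gt_eqF.
have MR0 : 0 < M%:R :> R.
  by apply: lt_le_trans M_ge; rewrite divr_gt0// mulr_gt0// exprn_gt0.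
have Nk_gt0 k y : y \in s -> 0 < (Nk k y)%:R :> R.
  move=> ys; rewrite ltr0n.
  apply: covered_gt0 ((Nk_spec k).1 y ys); [by []|lra|exact: (sS y ys).1].
have mult_gt0 k y : y \in s -> 0 < (fibre_mult s (direction R p k) rho y)%:R :> R.
  by move=> ys; rewrite ltr0n fibre_mult_gt0.
(* Jensen over the points of the net, in one direction. *)
have one_direction k : M%:R * ln M%:R + \sum_(y <- s)
    (ln (Nk k y)%:R - ln (fibre_mult s (direction R p k) rho y)%:R)
    <= M%:R * ln (N k)%:R :> R.
  have := @sum_ln_le R _ s
    (fun y => (Nk k y)%:R / (fibre_mult s (direction R p k) rho y)%:R)
    (fun y ys => divr_gt0 (Nk_gt0 k y ys) (mult_gt0 k y ys)).
  have -> : \sum_(y <- s) ln ((Nk k y)%:R /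
      (fibre_mult s (direction R p k) rho y)%:R) =
    \sum_(y <- s) (ln (Nk k y)%:R - ln (fibre_mult s (direction R p k) rho y)%:R) :> R.
    rewrite big_seq [RHS]big_seq; apply: eq_bigr => y ys.
    by rewrite ln_div ?posrE ?Nk_gt0 ?mult_gt0.
  move=> jensen; rewrite -lerBrDl -mulrBr; apply: le_trans jensen _.
  rewrite ler_pM2l//.
  have T0 : 0 < \sum_(y <- s)
      (Nk k y)%:R / (fibre_mult s (direction R p k) rho y)%:R :> R.
    apply: sumr_seq_gt0 => [|y ys]; first by rewrite -(ltr0n R).
    by rewrite divr_gt0 ?Nk_gt0 ?mult_gt0.
  rewrite ln_div ?posrE// lerB// ler_ln ?posrE//.
    exact: (Nk_spec k).2.
  exact: lt_le_trans T0 (Nk_spec k).2.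
(* Jensen over the directions, at one point of the net. *)
have one_point y : y \in s ->
    \sum_(k < p) ln (fibre_mult s (direction R p k) rho y)%:R <=
    p%:R * ln (mean_mult_bound A J) :> R.
  move=> ys; have [Sy xy] := sS y ys.
  have p0 : 0 < p%:R :> R by rewrite ltr0n pE muln_gt0 expn_gt0.
  have sizep : size (index_enum 'I_p) = p.
    by rewrite -sum1_size sum_nat_const card_ord muln1.
  have := @sum_ln_le R _ (index_enum 'I_p)
    (fun k : 'I_p => (fibre_mult s (direction R p k) rho y)%:R)
    (fun k _ => mult_gt0 k y ys).
  rewrite sizep => /le_trans; apply; rewrite ler_pM2l// ler_ln ?posrE.
  - rewrite ler_pdivrMr// mulrC.
    apply: (sum_fibre_mult_le pE reg A0 rho0 _ sep _ _ Sy); first by rewrite -rE.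
      by move=> z /sS[].
    move=> z /sS[_ xz]; rewrite -rE.
    by have := euclid_triangle x y z; rewrite (euclidC y x); lra.
  - rewrite divr_gt0//; apply: (@lt_le_trans _ _ (\sum_(k < p) 1)).
      by rewrite sumr_const card_ord.
    by apply: ler_sum => k _; rewrite ler1n -(ltr0n R) mult_gt0.
  - exact: mean_mult_bound_gt0.
have IHs y : y \in s -> n%:R * p%:R * scale_gain A J <=
    \sum_(k < p) ln (Nk k y)%:R.
  move=> ys; have rho_r0 : 2 * rho <= r0 by lra.
  apply: (IH rho y (Nk^~ y) rho_r0 delta_rho (sS y ys).1) => k.
  exact: (Nk_spec k).1.
rewrite -(ler_pM2l MR0) mulr_sumr.
apply: (@le_trans _ _ (\sum_(k < p) (M%:R * ln M%:R + \sum_(y <- s)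
    (ln (Nk k y)%:R - ln (fibre_mult s (direction R p k) rho y)%:R)))); last first.
  by apply: ler_sum => k _; exact: one_direction.
rewrite big_split /= sumr_const card_ord exchange_big /=.
have : \sum_(y <- s) (n%:R * p%:R * scale_gain A J -
      p%:R * ln (mean_mult_bound A J)) <=
    \sum_(y <- s) \sum_(k < p) (ln (Nk k y)%:R -
      ln (fibre_mult s (direction R p k) rho y)%:R).
  rewrite big_seq [leRHS]big_seq; apply: ler_sum => y ys.
  by rewrite sumrB lerB ?IHs ?one_point.
rewrite big_const_seq count_predT iter_addr_0 -/M -[leLHS]mulr_natl.
have : ln (2 ^+ J / (2 * A ^+ 2)) <= ln M%:R.
  by rewrite ler_ln ?posrE// divr_gt0// mulr_gt0// exprn_gt0.
rewrite -(ler_pM2l (mulr_gt0 MR0 (_ : 0 < p%:R))); last first.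
  by rewrite ltr0n pE muln_gt0 expn_gt0.
rewrite -[X in _ <= X + _]mulr_natl /scale_gain.
set SS := \sum_(y <- s) _; move: (ln (2 ^+ J / _)) (ln (mean_mult_bound _ _)) (ln M%:R).
move=> a b c h1 h2.
have -> : M%:R * (n.+1%:R * p%:R * (a - b)) =
   M%:R * (n%:R * p%:R * (a - b) - p%:R * b) + M%:R * p%:R * a.
  by rewrite -natr1; ring.
by rewrite addrC lerD// (le_trans h1)// mulrCA mulrA.
Qed.

(** The gain is [J ln 2] up to a logarithm of [J]. *)
Lemma exists_scale_gain (R : realType) (A s : R) : 0 < A -> s < 1 ->
  exists2 J : nat, (0 < J)%N & s * (J%:R * ln 2) <= scale_gain A J.
Proof.
move=> A0 s1; have ln2 : 0 < ln 2 :> R by rewrite ln_gt0// ltr1n.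
pose c := (1 - s) * ln 2; have c0 : 0 < c by rewrite mulr_gt0// subr_gt0.
pose B := 1296 * A ^+ 4.
have B0 : 0 <= B.
  by apply: mulr_ge0; [rewrite ler0n|apply: exprn_ge0; exact: ltW].
have [J Jpos JB] : exists2 J : nat, (0 < J)%N & 4 * B <= J%:R * c ^+ 2.
  exists (Num.truncn (4 * B / c ^+ 2)).+1; first exact: ltn0Sn.
  by rewrite -ler_pdivrMr ?exprn_gt0// ltW// truncnS_gt.
have J0 : 0 < J%:R :> R by rewrite ltr0n.
exists J => //.
have twoJ : 0 < 2 ^+ J :> R by rewrite exprn_gt0.
have net_mult : 2 * A ^+ 2 * mean_mult_bound A J <= B * (2 * J%:R).
  have -> : 2 * A ^+ 2 * mean_mult_bound A J = B * J.+1%:R.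
    by rewrite /mean_mult_bound /B; ring.
  clearbody B; by rewrite ler_wpM2l// -natrM ler_nat mul2n -addnn; lia.
have a0 : 0 < 2 * A ^+ 2 by apply: mulr_gt0; [rewrite ltr0n|exact: exprn_gt0].
have b0 := mean_mult_bound_gt0 J A0.
rewrite /scale_gain ln_div ?posrE// lnXn// -(mulr_natl (ln 2) J).
have -> : s * (J%:R * ln 2) = J%:R * ln 2 - c * J%:R by rewrite /c; ring.
(* The quadratic term of the exponential series at [c J] beats [B * 2 J]. *)
move: a0 b0 net_mult; move: (2 * A ^+ 2) (mean_mult_bound A J) => a b a0 b0 ab.
suff : ln a + ln b <= c * J%:R by lra.
rewrite -lnM ?posrE// -[leRHS]expRK ler_ln ?posrE ?mulr_gt0 ?expR_gt0//.
apply: (le_trans _ (expR_ge1Dxn 1 _)); last by rewrite mulr_ge0// ltW.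
have -> : (2`!)%:R = 2 :> R by [].
apply: (le_trans ab); rewrite exprMn.
have := ler_wpM2r (ltW J0) JB; clearbody B; clear -J0; nra.
Qed.

(** With [J] chosen to gain more than the exponent [s] at each scale, the bounded
    losses at the two ends of the range of scales are absorbed once [delta] is
    small. *)
Lemma mean_proj_covered_ge (R : realType) (A c s : R) :
  0 < A -> 0 < c -> 0 <= s -> s < 1 ->
  exists (p : nat) (delta0 : R), [/\ (0 < p)%N, 0 < delta0 &
    forall K : set 'rV[R]_2,
    ball_regular A (c / A) (hausdorff1_restr K) ->
    msupport (hausdorff1_restr K) !=set0 ->
    forall delta (N : 'I_p -> nat), 0 < delta -> delta <= delta0 ->
    (forall k : 'I_p,
       proj_covered K (direction R p k) delta (N k)) ->
    delta `^ (- s) <= p%:R^-1 * \sum_(k < p) (N k)%:R].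
Proof.
move=> A0 c0 s0 s1; pose s' := (1 + s) / 2.
have s'1 : s' < 1 by rewrite /s'; lra.
have [J J0 gain] := exists_scale_gain A0 s'1.
have ln2 : 0 < ln 2 :> R by rewrite ln_gt0// ltr1n.
have Jln2 : 0 < J%:R * ln 2 :> R by rewrite mulr_gt0// ltr0n.
move pE : (4 * 2 ^ J)%N => p.
have p_gt0 : (0 < p)%N by rewrite -pE muln_gt0 expn_gt0.
have p0 : 0 < p%:R :> R by rewrite ltr0n.
pose r := c / A / 2; have r0 : 0 < r by rewrite !divr_gt0.
pose L := s' * (J%:R * ln 2 - ln r) / (s' - s).
exists p, (Num.min r (expR (- L))); split => //; first by rewrite lt_min r0 expR_gt0.
move=> K reg [x Sx] delta N delta_gt0; rewrite le_min => /andP[delta_r delta_L] cov.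
(* The number of scales between [delta] and [r]. *)
have [n n_le n_gt] : exists2 n, n%:R * (J%:R * ln 2) <= ln r - ln delta &
    ln r - ln delta < (n%:R + 1) * (J%:R * ln 2).
  have ratio0 : 0 <= (ln r - ln delta) / (J%:R * ln 2).
    by rewrite divr_ge0 ?(ltW Jln2)// subr_ge0 ler_ln ?posrE.
  have /andP[n_le n_gt] := truncn_itv ratio0.
  exists (Num.truncn ((ln r - ln delta) / (J%:R * ln 2))).
    by rewrite -ler_pdivlMr.
  by rewrite -ltr_pdivrMr// natr1.
have delta_n : delta * 2 ^+ (J * n) <= r.
  have pow0 : 0 < 2 ^+ (J * n) :> R by rewrite exprn_gt0.
  rewrite -ler_ln ?posrE// ?mulr_gt0// lnM ?posrE//.
  rewrite lnXn// -(mulr_natl (ln 2)) -lerBrDl.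
  by have -> : (J * n)%:R * ln 2 = n%:R * (J%:R * ln 2) :> R
    by rewrite natrM; ring.
have cov_ball (k : 'I_p) : proj_covered (K `&` eball x r) (direction R p k) delta (N k).
  by apply: proj_covered_sub (cov k); exact: subIsetl.
have r_le : 2 * r <= c / A by rewrite /r; lra.
have := sum_ln_proj_covered_ge (esym pE) reg A0 J0 delta_gt0 r_le delta_n Sx cov_ball.
move=> entropy.
have N_gt0 (k : 'I_p) : 0 < (N k)%:R :> R.
  rewrite ltr0n; apply: proj_covered_gt0 (cov_ball k).
  by apply: (ball_regular_ball_neq0 reg) => //; lra.
have sizep : size (index_enum 'I_p) = p.
  by rewrite -sum1_size sum_nat_const card_ord muln1.
have := @sum_ln_le R _ (index_enum 'I_p) (fun k => (N k)%:R) (fun k _ => N_gt0 k).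
rewrite sizep => jensen.
have sum0 : 0 < \sum_(k < p) (N k)%:R :> R.
  by apply: sumr_seq_gt0 => //; rewrite sizep -(ltr0n R).
have delta_exp : L <= - ln delta.
  by rewrite lerNr -[leRHS]expRK ler_ln ?posrE ?expR_gt0.
have s'0 : 0 < s' - s by rewrite /s'; lra.
rewrite /L ler_pdivrMr// in delta_exp.
have many_scales : - (s * ln delta) <= s' * (n%:R * (J%:R * ln 2)).
  have : s' * (ln r - ln delta - J%:R * ln 2) <= s' * (n%:R * (J%:R * ln 2)).
    by rewrite ler_wpM2l//; [rewrite /s'; lra|lra].
  by move=> h; nra.
have mean_ln : - (s * ln delta) <= ln (p%:R^-1 * \sum_(k < p) (N k)%:R).
  rewrite -(ler_pM2l p0) [p%:R^-1 * _]mulrC; apply: le_trans jensen.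
  apply: le_trans entropy; rewrite -mulrA mulrCA ler_pM2l//.
  apply: le_trans many_scales _.
  by rewrite mulrCA ler_wpM2l.
rewrite /powR gt_eqF// mulNr -[leRHS]lnK ?posrE ?mulr_gt0 ?invr_gt0//.
by rewrite ler_expR.
Qed.

(** * Covering numbers and box dimension *)

Lemma proj_covered_covering_number (R : realType) n (E : set 'rV[R]_n) e
    (delta : R) :
  covering_number (proj_line e @` E) delta = +oo%E \/
  exists2 m, proj_covered E e delta m &
    covering_number (proj_line e @` E) delta = m%:R%:E.
Proof.
have [[m0 cov0]|no_cover] := pselect (exists m, proj_covered E e delta m).
  right; have exP : exists m, `[< proj_covered E e delta m >].
    by exists m0; apply/asboolP.
  case: (ex_minnP exP) => m /asboolP cov minm; exists m => //.
  apply/eqP; rewrite eq_le; apply/andP; split.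
    by apply: ereal_inf_lbound; exists m.
  apply: le_ereal_inf_tmp => _ [m' cov' <-]; rewrite lee_fin ler_nat.
  by apply: minm; apply/asboolP.
left; rewrite /covering_number (_ : [set _ | _ in _] = set0) ?ereal_inf0//.
by apply/seteqP; split => // z [m cov _]; apply: no_cover; exists m.
Qed.

Lemma covering_number_ge0 (R : realType) n (E : set 'rV[R]_n) (r : R) :
  (0 <= covering_number E r)%E.
Proof. by apply: le_ereal_inf_tmp => _ [m _ <-]; rewrite lee_fin. Qed.

(** The mean over the set of directions is a mean over indices because distinct
    indices give distinct directions: half of the difference of the angles lies
    strictly between [0] and [pi], where the sine does not vanish. *)
Lemma direction_inj (R : realType) (p : nat) :
  set_inj `I_p (@direction R p).
Proof.
have lt_inj k l : (k < l)%N -> (l < p)%N -> direction R p k <> direction R p l.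
  move=> kl lp e; have p0 : (0 < p)%N by exact: leq_ltn_trans lp.
  have p0R : 0 < p%:R :> R by rewrite ltr0n.
  have pi0 := pi_gt0 R.
  pose x : R := pi * ((l - k)%:R / p%:R).
  have x2 : x + x = 2 * pi * l%:R / p%:R - 2 * pi * k%:R / p%:R.
    by rewrite /x natrB ?(ltnW kl)//; field; rewrite gt_eqF.
  have x_gt0 : 0 < x by rewrite mulr_gt0// divr_gt0// ltr0n subn_gt0.
  have x_lt : x < pi.
    by rewrite gtr_pMr// ltr_pdivrMr// mul1r ltr_nat; lia.
  have := dotv_unit_vec (direction R p l) (2 * pi * k%:R / p%:R).
  rewrite -/(direction R p k) e direction_norm1 !mxE /= -cosB -x2 cosD.
  have := cos2Dsin2 x; have := sin_gt0_pi (_ : 0 < x < pi).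
  rewrite x_gt0 x_lt => /(_ isT) sinx; nra.
move=> k l; rewrite !inE /= => kp lp e.
by case: (ltngtP k l) => // [kl|lk]; [have := lt_inj _ _ kl lp e|
  have := lt_inj _ _ lk kp (esym e)].
Qed.

Lemma mean_covering_number_ge (R : realType) (K : set 'rV[R]_2) (p : nat)
    (a delta : R) : (0 < p)%N ->
  (forall N : 'I_p -> nat,
     (forall k : 'I_p, proj_covered K (direction R p k) delta (N k)) ->
     a <= p%:R^-1 * \sum_(k < p) (N k)%:R) ->
  (a%:E <= (p%:R^-1)%:E * \sum_(e \in directions p)
                            covering_number (proj_line e @` K) delta)%E.
Proof.
move=> p0 ha.
have p0R : 0 < p%:R :> R by rewrite ltr0n.
have -> : directions p = [set direction R p k | k in `I_p] by [].
rewrite (fsbig_image _ _ _ (@direction_inj R p)) -fsbig_ord.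
have [[k koo]|fin] := pselect (exists k : 'I_p,
    covering_number (proj_line (direction R p k) @` K) delta = +oo%E).
  set S := (\sum_(_ < p) _)%E; have -> : S = +oo%E.
    apply/eqP; rewrite /S esum_eqy; last first.
      by move=> i _; rewrite gt_eqF// (lt_le_trans _ (covering_number_ge0 _ _)).
    by apply/existsP; exists k; rewrite koo /=.
  by rewrite gt0_muley ?leey// lte_fin invr_gt0.
have attained (k : 'I_p) : exists m, proj_covered K (direction R p k) delta m /\
    covering_number (proj_line (direction R p k) @` K) delta = m%:R%:E.
  have [koo|[m cov mE]] := proj_covered_covering_number K (direction R p k) delta.
    by exfalso; apply: fin; exists k.
  by exists m.
have [N N_spec] := choice attained.
rewrite (eq_bigr (fun k : 'I_p => (N k)%:R%:E)); last first.
  by move=> k _; exact: (N_spec k).2.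
by rewrite sumEFin -EFinM lee_fin ha// => k; exact: (N_spec k).1.
Qed.

(** If all the box dimensions were less than [s], then at some small scale all
    the covering numbers would be less than [delta ^ (- s)], and so would their
    mean. *)
Lemma exists_upper_box_dim_ge (R : realType) (K : set 'rV[R]_2) (p : nat)
    (s delta0 : R) : (0 < p)%N -> 0 < delta0 ->
  (forall (delta : R) (N : 'I_p -> nat), 0 < delta -> delta <= delta0 ->
     (forall k : 'I_p, proj_covered K (direction R p k) delta (N k)) ->
     delta `^ (- s) <= p%:R^-1 * \sum_(k < p) (N k)%:R) ->
  exists2 e, directions p e & (s%:E <= upper_box_dim (proj_line e @` K))%E.
Proof.
move=> p0 delta0_gt0 mean; apply: contrapT => small.
have p0R : 0 < p%:R :> R by rewrite ltr0n.
pose ratio (k : nat) (d : R) :=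
  (lne (covering_number (proj_line (direction R p k) @` K) d)
   * ((- ln d)^-1)%:E)%E.
have near_small (k : 'I_p) : \forall d \near (0 : R)^'+, (ratio k d < s%:E)%E.
  have : (upper_box_dim (proj_line (direction R p k) @` K) < s%:E)%E.
    rewrite ltNge; apply/negP => h; apply: small.
    by exists (direction R p k) => //; exists (k : nat) => //=.
  rewrite /upper_box_dim limf_esupE => /ereal_inf_lt[_ [V FV <-] supV].
  apply: filterS FV => d Vd; apply: le_lt_trans supV.
  by apply: ereal_sup_ubound; exists d.
have [d [[[d_small d_gt0] d_lt1] d_le]] : exists d : R,
    (((forall k : 'I_p, (ratio k d < s%:E)%E) /\ 0 < d) /\ d < 1) /\ d <= delta0.
  apply: (@filter_ex _ ((0 : R)^'+)).
  apply: filterI; last exact: nbhs_right_ltW.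
  apply: filterI; last exact: nbhs_right_lt.
  apply: filterI; last exact: nbhs_right_gt.
  exact: filter_forall near_small.
have ln_d : 0 < - ln d by rewrite oppr_gt0 ln_lt0// d_gt0.
have attained (k : 'I_p) : exists m,
    proj_covered K (direction R p k) d m /\ m%:R < d `^ (- s).
  have := d_small k; rewrite /ratio.
  have [->|[m cov ->]] := proj_covered_covering_number K (direction R p k) d.
    by rewrite /lne /= gt0_mulye ?lte_fin ?invr_gt0// ltNge leey.
  move=> ln_small; exists m; split=> //.
  have [->|m0] := posnP m; first by rewrite powR_gt0.
  have m0R : 0 < m%:R :> R by rewrite ltr0n.
  rewrite lne_EFin// -EFinM lte_fin ltr_pdivrMr// in ln_small.
  rewrite /powR gt_eqF// -[ltLHS]lnK ?posrE// ltr_expR mulNr -mulrN.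
  exact: ln_small.
have [N N_spec] := choice attained.
have := mean d N d_gt0 d_le (fun k => (N_spec k).1).
apply/negP; rewrite -ltNge mulrC ltr_pdivrMr//.
have -> : d `^ (- s) * p%:R = \sum_(k < p) d `^ (- s).
  by rewrite sumr_const card_ord -[RHS]mulr_natr.
apply: ltr_sum => [|k _]; last exact: (N_spec k).2.
by apply/hasP; exists (Ordinal p0); rewrite ?mem_index_enum.
Qed.

Theorem theorem1p7 (R : realType) (c1 c2 : R) (c1_gt0 : 0 < c1)
    (c1_le_c2 : c1 <= c2) (s A : R) (s_ge : 1 / 2 <= s) (s_lt1 : s < 1)
    (A_gt0 : 0 < A) :
  exists (p : nat) (delta0 : R),
    [/\ (1 <= p)%N, 0 < delta0 &
    forall K : set 'rV[R]_2,
      K !=set0 -> K `<=` eball 0 1 -> AD_regular1 A K ->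
      (c1%:E <= hausdorff1 K <= c2%:E)%E ->
      (forall delta : R, 0 < delta -> delta <= delta0 ->
        ((delta `^ (- s))%:E <=
         (p%:R^-1)%:E * \sum_(e \in directions p)
                          covering_number (proj_line e @` K) delta)%E) /\
      (exists2 e, directions p e &
        (s%:E <= upper_box_dim (proj_line e @` K))%E)].
Proof.
have s0 : 0 <= s by apply: le_trans s_ge; rewrite divr_ge0.
have [p [delta0 [p0 delta0_gt0 mean]]] := mean_proj_covered_ge A_gt0 c1_gt0 s0 s_lt1.
exists p, delta0; split => // K _ _ adK /andP[c1K _].
have [reg supp] := AD_regular1_ball_regular A_gt0 c1_gt0 adK c1K.
split=> [delta delta_gt0 delta_le|].
  apply: mean_covering_number_ge => // N.
  exact: (mean K reg supp delta N delta_gt0 delta_le).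
apply: (exists_upper_box_dim_ge p0 delta0_gt0) => delta N.
exact: (mean K reg supp delta N).
Qed.
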